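(* Let $p$ be an odd prime and let $n$ be an integer. For every non-negative integer $l<n(p-1)/2$, $$v_p(\epsilon_l)>-n.$$
   Context: The sequence of rational numbers $\{\epsilon_i\}_{i=0}^\infty$ is defined by $\epsilon_0=1$ and, inductively for each integer $l\ge 1$, by $$\frac{1}{(2l+1)!}=\sum_{i=1}^l\ \sum_{\substack{j_1+\cdots+j_i=l\\ j_1,\dots,j_i\ge 1}}\frac{2^i\epsilon_i}{(2j_1)!\cdots(2j_i)!}.$$ Equivalently, it is the unique sequence satisfying $$\sum_{l=0}^\infty\frac{x^l}{(2l+1)!}=\sum_{i=0}^\infty\epsilon_i\left(\sum_{j=1}^\infty\frac{2x^j}{(2j)!}\right)^i$$ in the ring of formal power series $\mathbb{Q}[[x]]$. For a prime $p$ and a rational number $q$, $v_p(q)$ denotes the $p$-adic valuation of $q$: if $q=p^at/(p^bs)$ with $s,t$ integers prime to $p$, then $v_p(q)=a-b$, with the convention $v_p(0)=+\infty$. *)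

(* Defs.v *)
From mathcomp Require Import all_boot all_order all_algebra.
From mathcomp Require Import constructive_ereal.

Set Implicit Arguments.
Unset Strict Implicit.
Unset Printing Implicit Defensive.

Import Order.TTheory GRing.Theory Num.Theory.
Local Open Scope ring_scope.

(* (j_1, ..., j_i) is a tuple of positive integers with sum l. Bounding every *)
(* part by l, as the type 'I_l.+1 does, loses no tuple.                       *)
Definition composition (l i : nat) (j : {ffun 'I_i -> 'I_l.+1}) : bool :=
  [forall k, (0 < j k)%N] && ((\sum_(k < i) j k)%N == l).

Definition epsilon_sequence (eps : nat -> rat) : Prop :=
  eps 0%N = 1 /\
  forall l : nat, (1 <= l)%N ->
    1 / ((2 * l + 1)`!)%N%:R =
    \sum_(1 <= i < l.+1)
      \sum_(j : {ffun 'I_i -> 'I_l.+1} | composition j)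
        2 ^+ i * eps i / \prod_(k < i) ((2 * j k)`!)%N%:R.

Definition padic_valuation (p : nat) (q : rat) : \bar int :=
  if q == 0 then +oo%E
  else ((logn p `|numq q|)%:Z - (logn p `|denq q|)%:Z)%:E.

Lemma padic_valuationE (p : nat) (q : rat) (a b : nat) (t s : int) :
  prime p -> coprime p `|t| -> coprime p `|s| ->
  q = (p ^ a)%:R * t%:~R / ((p ^ b)%:R * s%:~R) ->
  padic_valuation p q = (a%:Z - b%:Z)%:E.
Proof.
move=> pp ct cs qE.
have nz (u : int) : coprime p `|u| -> u != 0.
  apply: contraTneq => ->; rewrite absz0 /coprime gcdn0.
  by rewrite neq_ltn prime_gt1 ?orbT.
have tn0 := nz _ ct; have sn0 := nz _ cs.
have p0 : (0 < p)%N := prime_gt0 pp.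
have pX k : (p ^ k)%:R != 0 :> rat by rewrite pnatr_eq0 -lt0n expn_gt0 p0.
have q0 : q != 0 by rewrite qE !(mulf_neq0, invr_neq0) ?intr_eq0.
rewrite /padic_valuation (negbTE q0); congr _%:E.
have key : numq q * ((p ^ b)%:Z * s) = (p ^ a)%:Z * t * denq q.
  apply: (@intr_inj rat); rewrite !rmorphM /= -!pmulrn.
  have := divq_num_den q; rewrite {3}qE => /eqP.
  rewrite eqr_div ?intr_eq0 ?denq_neq0 ?mulf_neq0 ?intr_eq0 //.
  by move=> /eqP.
have lz (u : int) : coprime p `|u| -> logn p `|u| = 0%N by exact: logn_coprime.
have := congr1 (fun z : int => logn p `|z|) key.
rewrite !abszM !lognM ?muln_gt0 ?expn_gt0 ?p0 ?absz_gt0 ?numq_eq0 ?denq_neq0 ?tn0 ?sn0 //.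
rewrite !absz_nat !pfactorK // (lz _ ct) (lz _ cs) !addn0 => E.
by apply/eqP; rewrite subr_eq addrAC eq_sym subr_eq -!PoszD E.
Qed.

Lemma sum_composition_diag (l : nat) :
  \sum_(j : {ffun 'I_l -> 'I_l.+1} | composition j)
    2 ^+ l / \prod_(k < l) ((2 * j k)`!)%N%:R = 1 :> rat.
Proof.
case: l => [|l].
  rewrite (eq_bigl xpredT) => [|j]; last first.
    by rewrite /composition big_ord0 andbT; apply/forallP => -[].
  under eq_bigr do rewrite big_ord0 divr1 expr0.
  by rewrite sumr_const card_ffun !card_ord.
have oneE : (inord 1 : 'I_l.+2) = 1%N :> nat by rewrite inordK.
rewrite (big_pred1 [ffun _ => inord 1]) => [|j].
  under eq_bigr do rewrite ffunE oneE muln1.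
  by rewrite prodr_const card_ord divff // expf_neq0.
apply/idP/eqP => [|->]; last first.
  apply/andP; split; first by apply/forallP => k; rewrite ffunE oneE.
  by under eq_bigr do rewrite ffunE oneE; rewrite sum1_card card_ord.
case/andP => /forallP jpos /eqP jsum; apply/ffunP => k; rewrite ffunE.
apply/val_inj; rewrite /= oneE.
have := leqif_sum (P := xpredT) (fun (i : 'I_l.+1) _ => leqif_eq (jpos i)).
by rewrite /= jsum sum1_card card_ord => -[_]; rewrite eqxx => /esym/forallP/(_ k)/eqP.
Qed.

Lemma epsilon_sequence_rec (eps : nat -> rat) (l : nat) : (1 <= l)%N ->
  \sum_(1 <= i < l.+1)
      \sum_(j : {ffun 'I_i -> 'I_l.+1} | composition j)
        2 ^+ i * eps i / \prod_(k < i) ((2 * j k)`!)%N%:R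
  = \sum_(1 <= i < l)
      \sum_(j : {ffun 'I_i -> 'I_l.+1} | composition j)
        2 ^+ i * eps i / \prod_(k < i) ((2 * j k)`!)%N%:R + eps l.
Proof.
move=> l1; rewrite big_nat_recr //=; congr (_ + _).
under eq_bigr do rewrite mulrAC.
by rewrite -mulr_suml sum_composition_diag mul1r.
Qed.

Lemma epsilon_sequence_unique (e f : nat -> rat) :
  epsilon_sequence e -> epsilon_sequence f -> e =1 f.
Proof.
move=> [e0 eS] [f0 fS] l; elim/ltn_ind: l => -[|l] IH; first by rewrite e0 f0.
have := eS l.+1 isT; rewrite (fS l.+1 isT) !epsilon_sequence_rec //.
rewrite [X in _ = X + _](eq_big_nat _ _ (F2 := fun i =>
   \sum_(j : {ffun 'I_i -> 'I_l.+2} | composition j)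
        2 ^+ i * f i / \prod_(k < i) ((2 * j k)`!)%N%:R)).
  by move/addrI.
by move=> i /andP[_ il]; apply: eq_bigr => j _; rewrite IH.
Qed.

Lemma epsilon_sequence_exists : exists eps, epsilon_sequence eps.
Proof.
pose step (n : nat) (f : nat -> rat) : nat -> rat := fun m =>
  if m == n.+1 then 1 / ((2 * n.+1 + 1)`!)%N%:R - \sum_(1 <= i < n.+1)
      \sum_(j : {ffun 'I_i -> 'I_n.+2} | composition j)
        2 ^+ i * f i / \prod_(k < i) ((2 * j k)`!)%N%:R else f m.
pose F n := iteri n step (fun=> 1).
have FE n m : (m <= n)%N -> F n m = F m m.
  elim: n => [|n IH]; first by rewrite leqn0 => /eqP ->.
  by rewrite leq_eqVlt => /orP[/eqP -> //|/ltnSE mn]; rewrite /F /= {1}/step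
     ltn_eqF ?ltnS // -/(F n) IH.
exists (fun n => F n n); split => // -[//|l] _.
rewrite epsilon_sequence_rec // {2}/F /= {1}/step eqxx -/(F l).
rewrite [X in _ = X + _](eq_big_nat _ _ (F2 := fun i =>
   \sum_(j : {ffun 'I_i -> 'I_l.+2} | composition j)
        2 ^+ i * F l i / \prod_(k < i) ((2 * j k)`!)%N%:R)).
  by rewrite addrC subrK.
by move=> i /andP[_ il]; apply: eq_bigr => j _; rewrite FE.
Qed.

(* Main.v *)
Require Import Defs.
From mathcomp Require Import all_boot all_order all_algebra.
From mathcomp Require Import constructive_ereal.
From mathcomp Require Import ring lra zify.

Set Implicit Arguments.
Unset Strict Implicit.
Unset Printing Implicit Defensive.

Import Order.TTheory GRing.Theory Num.Theory.
Local Open Scope ring_scope.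

(** With x = t^2, the series defining the eps_i reads
        sinh t / t = \sum_i eps_i y^i,   y = 2 cosh t - 2 = 4 sinh^2 (t / 2).
    Put s = sinh (t / 2), so that y = 4 s^2 and
        sinh t / t = s sqrt (1 + s^2) / arcsinh s.
    The reciprocal of the right-hand side has the classical expansion
        arcsinh s / (s sqrt (1 + s^2))
          = \sum_k (-1)^k (k!)^2 / (2 k + 1)! y^k = \sum_k d_k y^k,
    so the generating series of the eps_i is the inverse of the explicit series
    D = \sum_k d_k y^k ([asinh_eps]), which gives a recursion for the eps_l with
    coefficients d_k ([eps_rec]).

    Let p = 2 q + 1. Legendre's formula bounds the p-adic valuation of
    (2 k + 1)! / (k!)^2 by the number of i >= 1 with p^i <= 2 k + 1; as
    p^i >= 1 + 2 q i, there are at most k / q such i ([logn_odd_fact]). Hence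
    v_p (d_k) >= - floor (k / q), and since floor (k / q) is superadditive in k,
    the recursion passes the same bound on to the eps_l ([eps_padic]). Finally
    l < n q means floor (l / q) < n.

    The identity for D is proved with differential equations in x rather than
    with the function arcsinh. With S = sinh t / t one has y' = S,
    4 x S' + 2 S = 2 + y and y^2 + 4 y = 4 x S^2, while D satisfies
    y (4 + y) D' + (2 + y) D = 2; together they give 2 x G' + G = 1 for
    G = D(y) S, whose only power series solution is G = 1 ([asinh_cosh2]).
    A power series modulo X^N is represented by a polynomial, and an identity
    modulo X^N by the divisibility of a difference by 'X^N. *)

(** * Polynomials modulo a power of the variable *)

Lemma dvd_XnP (F : fieldType) (N : nat) (f : {poly F}) :
  reflect (forall m, (m < N)%N -> f`_m = 0) ('X^N %| f).
Proof.
apply: (iffP idP) => [/dvdpP[g ->] m mN|f0]; first by rewrite coefMXn mN.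
apply/dvdpP; exists (drop_poly N f); rewrite -[LHS](poly_take_drop N).
suff -> : take_poly N f = 0 by rewrite add0r.
by apply/polyP => m; rewrite coef_take_poly coef0; case: ifP => // /f0.
Qed.

(** Only the coefficients of f up to degree m matter, which lets the indices
    range over the finite type 'I_m.+1 before the product is expanded. *)
Lemma coef_expr (R : comNzRingType) (f : {poly R}) (i m : nat) :
  (f ^+ i)`_m =
  \sum_(j : {ffun 'I_i -> 'I_m.+1} | (\sum_(k < i) j k)%N == m)
    \prod_(k < i) f`_(j k).
Proof.
pose g := take_poly m.+1 f.
have -> : (f ^+ i)`_m = (g ^+ i)`_m.
  have fg : f = g + drop_poly m.+1 f * 'X^(m.+1) by rewrite poly_take_drop.
  apply/eqP; rewrite -subr_eq0 -coefB subrXX {1}fg addrAC subrr add0r.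
  by rewrite mulrAC coefMXn ltnSn.
have -> : g ^+ i = \prod_(k < i) \sum_(j < m.+1) f`_j *: 'X^j.
  by rewrite prodr_const card_ord /g /take_poly poly_def.
rewrite bigA_distr_bigA coef_sum [RHS]big_mkcond; apply: eq_bigr => j _.
rewrite scaler_prod coefZ prodrXr coefXn eq_sym.
by case: eqP => _; rewrite ?mulr1 ?mulr0.
Qed.

(** Substituting a series of valuation exactly 1 preserves valuations: it sends
    h X^N to h(X g) g^N X^N, and h(X g) g^N has constant coefficient
    h(0) g(0)^N. *)
Lemma dvd_Xn_comp (F : fieldType) (g f : {poly F}) (N : nat) :
  g.[0] != 0 -> 'X^N %| f \Po ('X * g) -> 'X^N %| f.
Proof.
move=> g0; elim: N => [|N IH] dvd; first by rewrite expr0 dvd1p.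
have /dvdpP[h fE] : 'X^N %| f.
  by apply: IH; apply: dvdp_trans dvd; rewrite exprS dvdp_mull.
move: dvd; rewrite fE comp_polyM rmorphXn /= comp_polyX exprMn exprSr mulrCA.
rewrite dvdp_mul2l ?expf_neq0 ?polyX_eq0 //.
rewrite -[X in X %| _]subr0 -polyC0 dvdp_XsubCl /root hornerM horner_comp horner_exp.
rewrite !hornerE mulf_eq0 expf_eq0 (negbTE g0) andbF orbF => h0.
by rewrite mulrC dvdp_mul // -[X in X %| _]subr0 -polyC0 dvdp_XsubCl.
Qed.

(** The operator a X d/dX + b multiplies X^m by a m + b, so it can be inverted
    on the degrees where a m + b is nonzero. This is how the differential
    equations below are integrated. *)
Lemma dvd_Xn_euler (F : numFieldType) (N a b : nat) (f : {poly F}) :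
  (forall m, (m < N)%N -> (0 < a * m + b)%N \/ f`_m = 0) ->
  'X^N %| a%:R * ('X * f^`()) + b%:R * f -> 'X^N %| f.
Proof.
move=> ab /dvd_XnP dvd; apply/dvd_XnP => m mN.
case: (ab m mN) => // ab0; have := dvd m mN.
rewrite coefD !mulr_natl !coefMn coefXM coef_deriv.
have -> : (if m == 0%N then 0 else f`_m.-1.+1 *+ m.-1.+1) = f`_m *+ m.
  by case: m {mN ab0}.
rewrite -mulrnA -mulrnDr mulnC => /eqP; rewrite mulrn_eq0 => /orP[|/eqP//].
by rewrite eqn0Ngt ab0.
Qed.

(** * The series sinh t / t, 2 cosh t - 2 and arcsinh s / (s sqrt (1 + s^2)) *)

(** Expansion of sinh t / t in x = t^2. *)
Definition sinhc_coef (l : nat) : rat := ((2 * l + 1)`!)%:R^-1.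

(** Expansion of 2 cosh t - 2 in x = t^2. *)
Definition cosh2_coef (j : nat) : rat :=
  if j == 0%N then 0 else 2 / ((2 * j)`!)%:R.

(** Expansion of arcsinh s / (s sqrt (1 + s^2)) in y = 4 s^2. *)
Definition asinh_coef (k : nat) : rat :=
  (-1) ^+ k * (k`!)%:R ^+ 2 / ((2 * k + 1)`!)%:R.

Definition sinhc N : {poly rat} := \poly_(l < N) sinhc_coef l.
Definition cosh2 N : {poly rat} := \poly_(j < N) cosh2_coef j.
Definition asinh N : {poly rat} := \poly_(k < N) asinh_coef k.

Lemma fact_neq0 n : (n`!)%:R != 0 :> rat.
Proof. by rewrite pnatr_eq0 -lt0n fact_gt0. Qed.

(** Both sides carry a factor X because differentiation loses one order of
    precision modulo X^N, which the operator X d/dX does not. *)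
Lemma deriv_cosh2 N : 'X^N %| 'X * (cosh2 N)^`() - 'X * sinhc N.
Proof.
apply/dvd_XnP => -[|m] mN; rewrite coefB !coefXM ?subrr //= coef_deriv !coef_poly.
rewrite mN (ltnW mN) /cosh2_coef /sinhc_coef /=.
have -> : (2 * m.+1 = (2 * m + 1).+1)%N by lia.
rewrite factS natrM -mulr_natr.
have -> : (2 * m + 1).+1%:R = 2 * m.+1%:R :> rat by rewrite -natrM; congr _%:R; lia.
by field; rewrite fact_neq0 nat1r pnatr_eq0.
Qed.

(** Applying 2 d/dt to t S = sinh t, where 2 x d/dx = t d/dt, gives
    4 x S' + 2 S = 2 cosh t = 2 + y. *)
Lemma deriv_sinhc N :
  'X^N %| 4%:R * ('X * (sinhc N)^`()) + 2%:R * sinhc N - (2%:R + cosh2 N).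
Proof.
apply/dvd_XnP => m mN.
rewrite coefB !coefD !mulr_natl !coefMn coefXM coef_deriv.
have -> : (if m == 0%N then 0 else (sinhc N)`_m.-1.+1 *+ m.-1.+1)
          = (sinhc N)`_m *+ m by case: m {mN}.
rewrite !coef_poly mN coef1 /cosh2_coef /sinhc_coef.
case: m mN => [|m] mN; first by rewrite -[_`!]/1%N invr1 /= mulr0n; ring.
rewrite addn1 factS natrM /=.
rewrite addr0 -mulrnA -(mulr_natr _ (_ * 4)).
have -> : (2 * m.+1).+1%:R = 2 * m.+1%:R + 1 :> rat by rewrite -natrM -addn1 natrD.
have m0 : 2 * m.+1%:R + 1 != 0 :> rat by rewrite -natrM -(natrD _ _ 1) pnatr_eq0 addn1.
have -> : (m.+1 * 4)%:R = 4 * m.+1%:R :> rat by rewrite mulnC natrM.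
by field; rewrite fact_neq0 nat1r m0.
Qed.

Lemma cosh2_0 N : (cosh2 N)`_0 = 0.
Proof. by rewrite coef_poly /cosh2_coef /=; case: ifP. Qed.

(** This is (2 cosh t)^2 - 4 = 4 sinh^2 t. The difference of the two sides has
    zero constant coefficient and zero derivative. *)
Lemma cosh2_sinhc N :
  'X^N %| cosh2 N ^+ 2 + 4%:R * cosh2 N - 4%:R * ('X * sinhc N ^+ 2).
Proof.
set Z := (X in _ %| X); apply: (@dvd_Xn_euler _ N 1 0).
  move=> [|m] _; last by left; lia.
  right; rewrite /Z !mulr_natl expr2 coefB coefD !coefMn coef0M cosh2_0 coefXM.
  by rewrite mul0r !mul0rn subrr.
have -> : 1%:R * ('X * Z^`()) + 0%:R * Z =
    (2%:R * cosh2 N + 4%:R) * ('X * (cosh2 N)^`() - 'X * sinhc N)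
    - 2%:R * 'X * sinhc N *
      (4%:R * ('X * (sinhc N)^`()) + 2%:R * sinhc N - (2%:R + cosh2 N)).
  rewrite /Z !mulr_natl !expr2 !(derivD, derivB, derivN, derivMn, derivM, derivX).
  ring.
by rewrite dvdp_sub // dvdp_mull // ?deriv_cosh2 ?deriv_sinhc.
Qed.

Lemma asinh_coefS k :
  (4 * k.+1%:R + 2) * asinh_coef k.+1 = - k.+1%:R * asinh_coef k.
Proof.
rewrite /asinh_coef exprS factS natrM.
have -> : (2 * k.+1 + 1 = (2 * k + 1).+2)%N by lia.
rewrite !(factS (_.+1), factS (2 * k + 1)) !natrM.
have -> : (2 * k + 1).+2%:R = 2 * k.+1%:R + 1 :> rat.
  by rewrite -natrM -(natrD _ _ 1); congr _%:R; lia.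
have -> : (2 * k + 1).+1%:R = 2 * k.+1%:R :> rat by rewrite -natrM; congr _%:R; lia.
have m0 : 2 * k.+1%:R + 1 != 0 :> rat by rewrite -natrM -(natrD _ _ 1) pnatr_eq0 addn1.
by field; rewrite fact_neq0 nat1r m0 pnatr_eq0.
Qed.

(** The differential equation that encodes the two-term recursion
    [asinh_coefS]. *)
Lemma deriv_asinh N :
  'X^N %| 'X * (4%:R + 'X) * (asinh N)^`() + (2%:R + 'X) * asinh N - 2%:R.
Proof.
have -> : 'X * (4%:R + 'X) * (asinh N)^`() + (2%:R + 'X) * asinh N - 2%:R =
   4%:R * ('X * (asinh N)^`()) + 2%:R * asinh N
   + 'X * ('X * (asinh N)^`() + asinh N) - 2%:R by ring.
have thE m : ('X * (asinh N)^`())`_m = (asinh N)`_m *+ m.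
  by rewrite coefXM coef_deriv; case: m.
apply/dvd_XnP => -[|m] mN; rewrite coefB !coefD !mulr_natl !coefMn thE coefXM coef1.
  have a0 : asinh_coef 0 = 1 by apply/eqP.
  by rewrite !coef_poly mN a0 /= mulr0n; ring.
rewrite /= coefD thE !coef_poly mN (ltnW mN).
rewrite -mulrSr -(mulr_natr (asinh_coef m)) -(mulr_natr (asinh_coef m.+1) m.+1).
have E := asinh_coefS m; lra.
Qed.

(** The identity D(y) = 1 / S: writing G = D(y) S, the differential equations of
    y, S and D combine into 4 x G' + 2 G = 2. *)
Lemma asinh_cosh2 N : 'X^N %| (asinh N \Po cosh2 N) * sinhc N - 1.
Proof.
set Y := cosh2 N; set S := sinhc N; pose A := asinh N \Po Y.
pose B := (asinh N)^`() \Po Y.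
have AB : 'X^N %| Y * (4%:R + Y) * B + (2%:R + Y) * A - 2%:R.
  have YX : 'X %| Y.
    by apply/(dvd_XnP 1) => -[|//] _; rewrite cosh2_0.
  apply: dvdp_trans (dvdp_exp2r N YX) _.
  have := dvdp_comp_poly Y (deriv_asinh N); rewrite comp_Xn_poly.
  suff -> : ('X * (4%:R + 'X) * (asinh N)^`() + (2%:R + 'X) * asinh N - 2%:R) \Po Y
            = Y * (4%:R + Y) * B + (2%:R + Y) * A - 2%:R by [].
  rewrite !(comp_polyB, comp_polyD, comp_polyM, comp_polyX) -polyC1 !comp_polyC.
  by rewrite polyC1 -/A -/B; ring.
apply: (@dvd_Xn_euler _ N 4 2) => [m _|]; first by left; lia.
(* Below, the first summand replaces X y' by X S, the second uses the equation
   of S, the third replaces 4 X S^2 by y^2 + 4 y, and the last is the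
   equation of D. *)
rewrite -/A derivB derivM deriv_comp -/B -polyC1 derivC subr0.
have -> : 4%:R * ('X * (B * Y^`() * S + A * S^`())) + 2%:R * (A * S - 1%:P) =
   4%:R * B * S * ('X * Y^`() - 'X * S)
   + A * (4%:R * ('X * S^`()) + 2%:R * S - (2%:R + Y))
   - B * (Y ^+ 2 + 4%:R * Y - 4%:R * ('X * S ^+ 2))
   + (Y * (4%:R + Y) * B + (2%:R + Y) * A - 2%:R) by rewrite polyC1; ring.
rewrite dvdp_add // dvdp_sub ?dvdp_add ?dvdp_mull //.
- exact: deriv_cosh2.
- exact: deriv_sinhc.
- exact: cosh2_sinhc.
Qed.

(** * The recursion for the sequence *)

(** The recursive definition of eps, read coefficient by coefficient, is the
    identity S = \sum_i eps_i y^i. *)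
Lemma sinhc_comp (eps : nat -> rat) N : epsilon_sequence eps ->
  'X^N %| sinhc N - (\poly_(i < N) eps i \Po cosh2 N).
Proof.
move=> [e0 eS]; apply/dvd_XnP => m mN.
have YX i : (m < i)%N -> (cosh2 N ^+ i)`_m = 0.
  move=> mi; have /dvdpP[U ->] : 'X^1 %| cosh2 N.
    by apply/dvd_XnP => -[|//] _; rewrite cosh2_0.
  by rewrite exprMn -exprM mul1n coefMXn mi.
rewrite coefB coef_poly mN poly_def raddf_sum coef_sum.
under eq_bigr => i _ do rewrite /= comp_polyZ comp_Xn_poly coefZ.
rewrite -(big_mkord xpredT (fun i => eps i * (cosh2 N ^+ i)`_m)).
rewrite (big_cat_nat _ mN) //= [X in _ - (_ + X)]big_nat_cond [X in _ - (_ + X)]big1; last first.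
  by move=> i /andP[/andP[/YX -> _] _]; rewrite mulr0.
rewrite addr0 big_ltn // expr0 coef1.
case: m mN YX => [|m] mN YX.
  by rewrite big_geq // e0 addr0 mulr1 subrr.
rewrite mulr0 add0r /sinhc_coef -[_^-1]mul1r eS //; apply/eqP; rewrite subr_eq0.
apply/eqP/eq_big_nat => i _; rewrite coef_expr mulr_sumr [LHS]big_mkcond [RHS]big_mkcond.
apply: eq_bigr => j _; rewrite /composition.
case: eqP => _; last by rewrite andbF.
rewrite andbT; case: ifPn => [/forallP jpos|/forallPn[k jk]]; last first.
  have /eqP jk0 : j k == 0%N :> nat by rewrite eqn0Ngt.
  by rewrite (bigD1 k) //= jk0 cosh2_0 mul0r mulr0.
rewrite [2 ^+ i * _]mulrC -mulrA; congr (_ * _).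
have -> : 2 ^+ i = \prod_(k < i) (2 : rat) by rewrite prodr_const card_ord.
rewrite -prodf_div; apply: eq_bigr => k _.
rewrite coef_poly (leq_trans (ltn_ord _) mN) /cosh2_coef.
by rewrite eqn0Ngt jpos.
Qed.

(** Both D(y) and \sum_i eps_i y^i are expressed by S, and y has valuation 1 in x,
    so an identity between series in y can be checked in x. The precision is at
    least 2 because modulo X the truncation of y is 0 and loses its
    valuation. *)
Lemma asinh_eps (eps : nat -> rat) N : epsilon_sequence eps ->
  'X^(N.+2) %| asinh N.+2 * (\poly_(i < N.+2) eps i) - 1.
Proof.
move=> heps; pose U := drop_poly 1 (cosh2 N.+2).
have YE : cosh2 N.+2 = 'X * U.
  rewrite -[LHS](poly_take_drop 1) expr1 mulrC /take_poly poly_def big_ord1.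
  by rewrite cosh2_0 scale0r add0r.
apply: (@dvd_Xn_comp _ U).
  by rewrite horner_coef0 coef_drop_poly coef_poly.
rewrite -YE comp_polyB comp_polyM -polyC1 comp_polyC.
set A := asinh _ \Po _; set E := _ \Po _; set S := sinhc N.+2.
have -> : A * E - 1%:P = (A * S - 1) - A * (S - E) by rewrite polyC1; ring.
by rewrite dvdp_sub ?dvdp_mull ?asinh_cosh2 ?sinhc_comp.
Qed.

Lemma eps_rec (eps : nat -> rat) l : epsilon_sequence eps ->
  eps l.+1 = - \sum_(k < l.+1) asinh_coef k.+1 * eps (l - k)%N.
Proof.
move=> heps; have /dvd_XnP/(_ l.+1 (ltnSn _)) := asinh_eps l heps.
rewrite coefB coefM coef1 subr0 big_ord_recl /= => /eqP.
rewrite addr_eq0 !coef_poly /= subn0 ltnSn.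
have -> : asinh_coef 0 = 1 by apply/eqP.
rewrite mul1r => /eqP ->; congr (- _); apply: eq_bigr => k _.
rewrite !coef_poly /bump /= add1n subSS ltnS ltn_ord.
by rewrite ltnS leqW // leq_subr.
Qed.

(** * Denominators at an odd prime *)

Definition padic_integral (p : nat) (x : rat) : Prop :=
  exists2 s : nat, coprime p s & s%:R * x \is a Num.int.

Lemma padic_integral_int p x : x \is a Num.int -> padic_integral p x.
Proof. by exists 1%N; rewrite ?coprimen1 ?mul1r. Qed.

Lemma padic_integralM p x y :
  padic_integral p x -> padic_integral p y -> padic_integral p (x * y).
Proof.
move=> [s ps sx] [t pt ty]; exists (s * t)%N; first by rewrite coprimeMr ps.
by rewrite natrM mulrACA rpredM.
Qed.

Lemma padic_integralD p x y :
  padic_integral p x -> padic_integral p y -> padic_integral p (x + y).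
Proof.
move=> [s ps sx] [t pt ty]; exists (s * t)%N; first by rewrite coprimeMr ps.
rewrite natrM mulrDr mulrAC -[_ * t%:R * y]mulrA.
by apply: rpredD; apply: rpredM; rewrite ?rpred_nat.
Qed.

Lemma padic_valuation_gt (p a : nat) (n : int) (x : rat) :
  prime p -> padic_integral p ((p ^ a)%:R * x) -> a%:Z < n ->
  ((- n)%:E < padic_valuation p x)%E.
Proof.
move=> pp [s ps /intrP[u uE]] an; rewrite /padic_valuation.
have p0 := prime_gt0 pp.
case: eqVneq => [_|x0]; first by rewrite ltry.
have key : s%:Z * (p ^ a)%:Z * numq x = u * denq x.
  apply: (@intr_inj rat); rewrite !rmorphM /= -uE -!pmulrn numqE.
  by rewrite !mulrA.
have s0 : (0 < s)%N.
  rewrite lt0n; apply: contraTneq ps => ->; rewrite /coprime gcdn0.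
  by rewrite neq_ltn prime_gt1 ?orbT.
have u0 : u != 0.
  apply: contraNneq x0 => u0; move/eqP: key.
  rewrite u0 mul0r !mulf_eq0 numq_eq0 => /orP[/orP[]|//]; rewrite eqz_nat.
    by rewrite eqn0Ngt s0.
  by rewrite expn_eq0 eqn0Ngt p0.
have := congr1 (fun z : int => logn p `|z|) key.
rewrite !abszM !absz_nat !lognM ?muln_gt0 ?expn_gt0 ?p0 ?absz_gt0 ?numq_eq0
  ?denq_neq0 ?s0 ?x0 ?u0 //.
rewrite (logn_coprime ps) pfactorK // add0n lte_fin => E; lia.
Qed.

(** Legendre's formula compared term by term: (2 k + 1) / p^i exceeds twice
    k / p^i by at most 1, and only when p^i <= 2 k + 1. The latter forces
    i <= k / q, since p^i = (1 + 2 q)^i >= 1 + 2 q i. *)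
Lemma logn_odd_fact p q k : prime p -> p = q.*2.+1 ->
  (logn p (2 * k + 1)`! <= k %/ q + 2 * logn p k`!)%N.
Proof.
move=> pp pE; have q0 : (0 < q)%N by case: q pE pp => // ->.
have pX i : (0 < p ^ i)%N by rewrite expn_gt0 prime_gt0.
have -> : logn p k`! = (\sum_(1 <= i < (2 * k + 1).+1) k %/ p ^ i)%N.
  rewrite logn_fact // [RHS](@big_cat_nat _ _ _ k.+1) //=; last by lia.
  rewrite [X in _ = (_ + X)%N]big_nat_cond [X in _ = (_ + X)%N]big1 ?addn0 // => i /andP[/andP[ki _] _].
  by rewrite divn_small // (ltn_trans ki) // ltn_expl // prime_gt1.
have le_q i : (p ^ i <= 2 * k + 1)%N -> (i <= k %/ q)%N.
  rewrite leq_divRL // => le_p; suff : (2 * (i * q) + 1 <= p ^ i)%N by lia.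
  elim: i {le_p} => // i IH; rewrite expnS pE; move: IH; rewrite pE; nia.
apply: (@leq_trans (\sum_(1 <= i < (2 * k + 1).+1) ((i <= k %/ q) + 2 * (k %/ p ^ i)))%N).
  rewrite logn_fact // !big_nat; apply: leq_sum => i _.
  have [lt_p|/le_q ->] := ltnP (2 * k + 1)%N (p ^ i); first by rewrite divn_small.
  rewrite -ltnS ltn_divLR //.
  have := divn_eq k (p ^ i); have := ltn_pmod k (pX i); nia.
(* The indicators of i <= k / q add up to at most k / q. *)
rewrite big_split -big_distrr leq_add2r /=.
suff -> M : (\sum_(1 <= i < M.+1) (i <= k %/ q) = minn M (k %/ q))%N by rewrite geq_minr.
elim: M => [|M IH]; first by rewrite big_geq // min0n.
by rewrite big_nat_recr //= IH; lia.
Qed.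

Lemma asinh_coef_padic p q k : prime p -> p = q.*2.+1 ->
  padic_integral p ((p ^ (k %/ q))%:R * asinh_coef k).
Proof.
move=> pp pE; have := logn_odd_fact k pp pE.
have := pfactor_coprime pp (fact_gt0 (2 * k + 1)); set v := logn _ _ => -[w pw wE].
have := pfactor_coprime pp (fact_gt0 k); set v' := logn p k`! => -[w' pw' w'E] vE.
exists w => //.
rewrite /asinh_coef wE w'E !natrM.
have w0 : w%:R != 0 :> rat.
  rewrite pnatr_eq0; apply: contraTneq pw => ->; rewrite /coprime gcdn0.
  by rewrite neq_ltn prime_gt1 ?orbT.
have p0 i : (p ^ i)%:R != 0 :> rat by rewrite pnatr_eq0 expn_eq0 eqn0Ngt prime_gt0.
suff -> : w%:R * ((p ^ (k %/ q))%:R *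
    ((-1) ^+ k * (w'%:R * (p ^ v')%:R) ^+ 2 / (w%:R * (p ^ v)%:R))) =
    (-1) ^+ k * (w' * w' * p ^ (k %/ q + 2 * v' - v))%:R :> rat.
  by rewrite rpredM ?rpredX ?rpredN ?rpred1 ?rpred_nat.
have E : (p ^ (k %/ q))%:R * (p ^ v')%:R ^+ 2 = (p ^ (k %/ q + 2 * v' - v))%:R * (p ^ v)%:R :> rat.
  by rewrite -natrX -!natrM -expnM -!expnD [(v' * 2)%N]mulnC subnK.
rewrite !natrM; have := p0 v; move: E.
set V : rat := (p ^ v)%:R; set P : rat := (p ^ (k %/ q))%:R.
set P' : rat := (p ^ v')%:R; set R : rat := (p ^ _)%:R => E V0.
clearbody V P P' R.
transitivity ((-1) ^+ k * w'%:R ^+ 2 * (P * P' ^+ 2) / V).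
  by field; rewrite w0 V0.
by rewrite E; field.
Qed.

(** The bound k / q of [asinh_coef_padic] propagates through [eps_rec] because
    k.+1 / q + (l - k) / q <= l.+1 / q. *)
Lemma eps_padic (eps : nat -> rat) p q l : epsilon_sequence eps ->
  prime p -> p = q.*2.+1 -> padic_integral p ((p ^ (l %/ q))%:R * eps l).
Proof.
move=> heps pp pE; have q0 : (0 < q)%N by case: q pE pp => // ->.
elim/ltn_ind: l => -[|l] IH.
  by case: heps => -> _; rewrite mulr1; apply/padic_integral_int/rpred_nat.
rewrite eps_rec // mulrN -mulN1r; apply: padic_integralM.
  by apply: padic_integral_int; rewrite rpredN rpred1.
rewrite mulr_sumr; elim/big_ind: _ => [||k _].
- exact/padic_integral_int/rpred0.
- exact: padic_integralD.
have le_f : (k.+1 %/ q + (l - k) %/ q <= l.+1 %/ q)%N.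
  rewrite leq_divRL // mulnDl.
  have := leq_trunc_div k.+1 q; have := leq_trunc_div (l - k) q; have := ltn_ord k; lia.
rewrite -(subnK le_f) !expnD !natrM -mulrA; apply: padic_integralM.
  exact/padic_integral_int/rpred_nat.
rewrite mulrACA; apply: padic_integralM; first exact: asinh_coef_padic.
by apply: IH; rewrite ltnS leq_subr.
Qed.

Theorem theorem5p5 (eps : nat -> rat) (heps : epsilon_sequence eps)
    (p : nat) (hp : prime p) (hodd : odd p) (n : int) (l : nat)
    (hl : l%:R < n%:~R * (p%:R - 1) / 2 :> rat) :
  ((- n)%:E < padic_valuation p (eps l))%E.
Proof.
have pE : p = (p./2).*2.+1 by rewrite -[LHS]odd_double_half hodd.
apply: (padic_valuation_gt hp (eps_padic l heps hp pE)).
have q0 : (0 < p./2)%N by case: (p) hodd (prime_gt1 hp) => [|[|[]]].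
have : l%:Z < n * (p./2)%:Z.
  rewrite -(ltr_int rat) rmorphM /= -!pmulrn; move: hl.
  rewrite {1}pE -natr1 addrK -muln2 natrM; lra.
have := leq_trunc_div l p./2; nia.
Qed.
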